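(* Let $\mathbf{x}(s)$, $s\in I$, be a multiplicative biregular curve in $\mathbb{E}_*^3$ parametrized by multiplicative arc length, with multiplicative curvature $\kappa$ and multiplicative torsion $\tau$. If $\mathbf{x}$ is a multiplicative rectifying curve, then there are $c,d\in\mathbb{R}_*$ with $c\neq0_*$ such that for all $s\in I$ $$\tau(s)/_*\kappa(s)=c\cdot_*s+_*d=e^{\log c\,\log s+\log d}.$$ Conversely, if there are $c,d\in\mathbb{R}_*$, $c\neq0_*$, such that this identity holds for all $s\in I$, then $\mathbf{x}$ is a multiplicative rectifying curve.
   Context: Multiplicative arithmetic. $\mathbb{R}_*$ is the set of positive reals with the field operations $a+_*b=e^{\log a+\log b}$, $a-_*b=e^{\log a-\log b}$, $a\cdot_*b=e^{\log a\log b}$, $a/_*b=e^{\log a/\log b}$ ($b\ne1$); $0_*=1$, $1_*=e$; $>$ is the usual order. Also $a^{2_*}=e^{(\log a)^2}$ and $a^{\frac12_*}=e^{\sqrt{\log a}}$ (for $a\ge 1$). Multiplicative derivative. For $f:I\to\mathbb{R}_*$, $I\subset\mathbb{R}_*$ an interval, $f^*(s)=\lim_{h\to1}(f(s+_*h)-_*f(s))/_*h=e^{s(\log f(s))'}$, with $'$ the usual derivative. All functions are multiplicative differentiable to whatever order is needed. For vector-valued functions the derivative is taken componentwise. Multiplicative Euclidean space. $\mathbb{E}_*^3$ is $\mathbb{R}_*^3$ with $\mathbf{x}+_*\mathbf{y}=(x_iy_i)_i$, $a\cdot_*\mathbf{x}=(e^{\log a\log x_i})_i$, zero vector $\mathbf{0}_*=(1,1,1)$,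 inner product $\langle\mathbf{x},\mathbf{y}\rangle_*=e^{\sum_i\log x_i\log y_i}$, norm $\|\mathbf{x}\|_*=\langle\mathbf{x},\mathbf{x}\rangle_*^{\frac12_*}=e^{\sqrt{\sum_i(\log x_i)^2}}$. Cross product: $\mathbf{x}\times_*\mathbf{y}=(e^{\log x_2\log y_3-\log x_3\log y_2},e^{\log x_3\log y_1-\log x_1\log y_3},e^{\log x_1\log y_2-\log x_2\log y_1})$. Vectors are multiplicative collinear iff their cross product is $\mathbf{0}_*$. Subtraction of vectors and scalar division $\mathbf{x}/_*a$ are componentwise. Curves. $\mathbf{x}:I\to\mathbb{E}_*^3$ is parametrized by multiplicative arc length if $\|\mathbf{x}^*(s)\|_*=1_*$ for all $s$; it is multiplicative biregular if $\mathbf{x}^*(s)$ and $\mathbf{x}^{**}(s)$ are nowhere multiplicative collinear (so $\kappa$ is nowhere $0_*$). The multiplicative Frenet frame of a biregular arc length parametrized curve is $\mathbf{t}=\mathbf{x}^*$, $\mathbf{n}=\mathbf{x}^{**}/_*\|\mathbf{x}^{**}\|_*$, $\mathbf{b}=\mathbf{t}\times_*\mathbf{n}$. The multiplicative curvature and torsion are $\kappa=\|\mathbf{x}^{**}\|_*$ and $\tau=\langle\mathbf{n}^*,\mathbf{b}\rangle_*$. A multiplicative biregular curve $\mathbf{x}$ is a multiplicative rectifying curve if $\langle\mathbf{x}(s),\mathbf{n}(s)\rangle_*=0_*$ for every $s\in I$.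
   Formalization: The converse is false as stated, since curvature and torsion are unchanged by multiplicative translations but the rectifying condition is not; its conclusion is corrected to: there is a point p in E_*^3 such that x -_* p is a multiplicative rectifying curve. *)

(* Defs.v *)
From HB Require Import structures.
From mathcomp Require Import all_boot all_order all_algebra.
From mathcomp Require Import all_classical all_reals all_analysis.

Set Implicit Arguments.
Unset Strict Implicit.
Unset Printing Implicit Defensive.

Import Order.TTheory GRing.Theory Num.Theory.
Import numFieldNormedType.Exports.

Local Open Scope classical_set_scope.
Local Open Scope ring_scope.

(* The multiplicative reals are the positive elements of R, and the
   multiplicative space E_*^3 consists of the 'rV[R]_3 with positive entries:
   positivity is a hypothesis, not part of the types.  (Here ln x = 0 for
   x <= 0.)  *)

Section Arithmetic.
Context {R : realType}.
Implicit Types a b : R.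

Definition madd a b : R := expR (ln a + ln b).
Definition msub a b : R := expR (ln a - ln b).
Definition mmul a b : R := expR (ln a * ln b).
Definition mdiv a b : R := expR (ln a / ln b).
Definition mreal0 : R := 1.
Definition mreal1 : R := expR 1.
Definition msqrt a : R := expR (Num.sqrt (ln a)).

End Arithmetic.

Section Space.
Context {R : realType}.
Implicit Types (a : R) (x y : 'rV[R]_3).

Definition mpos x : Prop := forall i, 0 < x 0 i.

Definition mvec0 : 'rV[R]_3 := \row_i mreal0.
Definition mvsub x y : 'rV[R]_3 := \row_i msub (x 0 i) (y 0 i).
Definition mvdiv x a : 'rV[R]_3 := \row_i mdiv (x 0 i) a.

Definition minner x y : R := expR (\sum_i ln (x 0 i) * ln (y 0 i)).
Definition mnorm x : R := msqrt (minner x x).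

(* The indices live in 'I_3, so i + 1 and i + 2 are taken modulo 3. *)
Definition mcross x y : 'rV[R]_3 :=
  \row_i expR (ln (x 0 (i + 1)) * ln (y 0 (i + 2%:R))
               - ln (x 0 (i + 2%:R)) * ln (y 0 (i + 1))).

Definition mcollinear x y : Prop := mcross x y = mvec0.

End Space.

Section Derivative.
Context {R : realType}.
Implicit Types (I : set R) (f : R -> R) (x : R -> 'rV[R]_3) (s h : R).

(* A multiplicative interval containing at least two points; its endpoints
   may or may not belong to it. *)
Definition minterval I : Prop :=
  [/\ is_interval I, I `<=` [set s | 0 < s] &
      exists s1 s2, [/\ I s1, I s2 & s1 < s2]].

Definition mquot f s h : R := mdiv (msub (f (madd s h)) (f s)) h.

(* h tends to 1 = 0_*, with h != 1 and s +_* h in I: the derivative at an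
   endpoint of I is one-sided, and values of f outside I are irrelevant. *)
Definition mincr I s : set_system R := within [set h | I (madd s h)] (1 : R)^'.

(* The limit has to exist in R_*: a limit equal to 0 is excluded. *)
Definition mderivable I f s : Prop :=
  exists2 l : R, 0 < l & mquot f s h @[h --> mincr I s] --> l.

Definition mderiv I f s : R := lim (mquot f s h @[h --> mincr I s]).

Definition mvderiv I x s : 'rV[R]_3 := \row_i mderiv I (fun u => x u 0 i) s.

Fixpoint mdifferentiable I (n : nat) x : Prop :=
  if n is m.+1 then
    (forall s, I s -> forall i, mderivable I (fun u => x u 0 i) s) /\
    mdifferentiable I m (mvderiv I x)
  else True.

End Derivative.

Section Curves.
Context {R : realType}.
Implicit Types (I : set R) (x : R -> 'rV[R]_3) (s : R).

Definition marclength I x : Prop :=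
  forall s, I s -> mnorm (mvderiv I x s) = mreal1.

Definition mbiregular I x : Prop :=
  forall s, I s -> ~ mcollinear (mvderiv I x s) (mvderiv I (mvderiv I x) s).

(* Frenet apparatus of a biregular curve parametrized by arc length. *)
Definition mtangent I x s : 'rV[R]_3 := mvderiv I x s.
Definition mcurvature I x s : R := mnorm (mvderiv I (mvderiv I x) s).
Definition mnormal I x s : 'rV[R]_3 :=
  mvdiv (mvderiv I (mvderiv I x) s) (mnorm (mvderiv I (mvderiv I x) s)).
Definition mbinormal I x s : 'rV[R]_3 :=
  mcross (mtangent I x s) (mnormal I x s).
Definition mtorsion I x s : R :=
  minner (mvderiv I (mnormal I x) s) (mbinormal I x s).

Definition mrectifying I x : Prop :=
  mbiregular I x /\ forall s, I s -> minner (x s) (mnormal I x s) = mreal0.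

(* The rectifying condition refers to the origin 0_*, whereas curvature and
   torsion are invariant under multiplicative translations.  A curve is
   rectifying up to translation if its position vector, taken from a suitable
   point p of E_*^3, satisfies the rectifying condition. *)
Definition mrectifying_up_to_translation I x : Prop :=
  exists2 p : 'rV[R]_3, mpos p & mrectifying I (fun s => mvsub (x s) p).

End Curves.

(* Main.v *)
(* In the coordinate u = log s, with X = log x taken componentwise, the
   multiplicative derivative, curvature, torsion and Frenet frame become the
   ordinary ones of the unit speed curve X(u), so the Frenet equations hold.

   If <X, N> = 0, then <X, T>' = 1 and <X, B>' = 0, so <X, T> = u + c0 and
   <X, B> = b; differentiating <X, N> = 0 gives tau b = kappa (u + c0), and
   b = 0 would force u + c0 = 0 on an interval.  Conversely, if
   tau / kappa = c u + d with c != 0, then X - (u + d / c) T - (1 / c) B has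
   zero derivative; it is the point P for which X - P has no N-component. *)

Require Import Defs.
From mathcomp Require Import all_boot all_order all_algebra.
From mathcomp Require Import all_classical all_reals all_analysis.
From mathcomp Require Import ring lra.

Import Order.TTheory GRing.Theory Num.Theory.
Import numFieldNormedType.Exports.

Local Open Scope classical_set_scope.
Local Open Scope ring_scope.

Set Implicit Arguments.
Unset Strict Implicit.

(** * Differential calculus relative to a subset of the line *)

Section RelativeDerivative.
Context {R : realType}.
Implicit Types (J : set R) (f g : R -> R) (u v l m : R).

(* Caratheodory's form of differentiability: the limit runs over v in J, the
   value v = u included, so derivatives at endpoints are one-sided and the
   product and chain rules need no division. *)
Definition der_in J f u l : Prop :=
  exists2 q : R -> R, (forall v, J v -> f v - f u = (v - u) * q v) &
    q v @[v --> within J (nbhs u)] --> l.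

Lemma der_in_cvg J f u l : der_in J f u l ->
  f v @[v --> within J (nbhs u)] --> f u.
Proof.
move=> [q qE ql].
have h : f u + (v - u) * q v @[v --> within J (nbhs u)] --> f u + (u - u) * l.
  apply: cvgD; first exact: cvg_cst.
  apply: cvgM ql; apply: cvgB; last exact: cvg_cst.
  exact: cvg_within.
rewrite subrr mul0r addr0 in h; apply: cvg_trans h.
apply: near_eq_cvg; near=> v.
rewrite -qE; first by rewrite addrC subrK.
by near: v; exact: withinT.
Unshelve. all: by end_near. Qed.

Lemma der_in_eq J f g u l : J u -> (forall v, J v -> f v = g v) ->
  der_in J f u l -> der_in J g u l.
Proof. by move=> Ju fg [q qE ql]; exists q => // v Jv; rewrite -!fg// qE. Qed.

Lemma der_in_cst J c u : der_in J (fun=> c) u 0.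
Proof.
exists (fun=> 0); last exact: cvg_cst.
by move=> v _; rewrite subrr mulr0.
Qed.

Lemma der_in_id J u : der_in J (fun v => v) u 1.
Proof. by exists (fun=> 1); [move=> v _; rewrite mulr1 | exact: cvg_cst]. Qed.

Lemma der_inD J f g u l m : der_in J f u l -> der_in J g u m ->
  der_in J (fun v => f v + g v) u (l + m).
Proof.
move=> [p pE pl] [q qE ql]; exists (fun v => p v + q v); last exact: cvgD.
by move=> v Jv; rewrite mulrDr -pE// -qE//; ring.
Qed.

Lemma der_inM J f g u l m : J u -> der_in J f u l -> der_in J g u m ->
  der_in J (fun v => f v * g v) u (l * g u + f u * m).
Proof.
move=> Ju fl gm; have fc := der_in_cvg fl.
have [p pE pl] := fl; have [q qE ql] := gm.
(* The increment splits as [(f v - f u) * g u + f v * (g v - g u)]; the factor [f v] is why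
   continuity of [f] is used. *)
exists (fun v => p v * g u + f v * q v).
  move=> v Jv; transitivity ((f v - f u) * g u + f v * (g v - g u)); first ring.
  by rewrite pE// qE//; ring.
by apply: cvgD; apply: cvgM => //; exact: cvg_cst.
Qed.

Lemma der_inZ J f u l c : J u -> der_in J f u l ->
  der_in J (fun v => c * f v) u (c * l).
Proof.
move=> Ju fl; rewrite -[c * l]add0r -(mul0r (f u)).
exact: der_inM (der_in_cst _ _ _) fl.
Qed.

Lemma der_inB J f g u l m : J u -> der_in J f u l -> der_in J g u m ->
  der_in J (fun v => f v - g v) u (l - m).
Proof.
move=> Ju fl gm; rewrite -[- m]mulN1r.
apply: (@der_in_eq _ (fun v => f v + (-1) * g v)) => //.
  by move=> v _; rewrite mulN1r.
by apply: der_inD => //; exact: der_inZ.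
Qed.

Lemma der_in_sum J (T : finType) (f : T -> R -> R) u (l : T -> R) :
  (forall i, der_in J (f i) u (l i)) ->
  der_in J (fun v => \sum_i f i v) u (\sum_i l i).
Proof.
move=> fl; rewrite /index_enum; elim: (Finite.enum T) => [|i s IH].
  rewrite big_nil; under eq_fun do rewrite big_nil; exact: der_in_cst.
by rewrite big_cons; under eq_fun do rewrite big_cons; exact: der_inD.
Qed.

(** Factor [a - b] as [(sqrt a - sqrt b) * (sqrt a + sqrt b)]; positivity at [u] alone keeps the
    second factor nonzero, in the limit too. *)
Lemma der_in_sqrt J f u l : J u -> (forall v, J v -> 0 <= f v) -> 0 < f u ->
  der_in J f u l ->
  der_in J (fun v => Num.sqrt (f v)) u (l / (Num.sqrt (f u) + Num.sqrt (f u))).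
Proof.
move=> Ju f0 fu0 fl; have fc := der_in_cvg fl; have [p pE pl] := fl.
have su0 : 0 < Num.sqrt (f u) by rewrite sqrtr_gt0.
exists (fun v => p v / (Num.sqrt (f v) + Num.sqrt (f u))).
  move=> v Jv; rewrite mulrA -pE//.
  have -> : f v - f u = Num.sqrt (f v) ^+ 2 - Num.sqrt (f u) ^+ 2.
    by rewrite !sqr_sqrtr ?f0.
  by rewrite subr_sqr mulfK// gt_eqF// ltr_wpDl// sqrtr_ge0.
apply: cvgM => //; apply: cvgV; first by rewrite gt_eqF// addr_gt0.
apply: cvgD; last exact: cvg_cst.
by apply: (cvg_comp _ _ fc); exact: sqrt_continuous.
Qed.

Lemma der_inV J f u l : J u -> (forall v, J v -> f v != 0) ->
  der_in J f u l -> der_in J (fun v => (f v)^-1) u (- (l / (f u * f u))).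
Proof.
move=> Ju f0 fl; have fc := der_in_cvg fl; have [p pE pl] := fl.
exists (fun v => - (p v / (f v * f u))).
  move=> v Jv; rewrite mulrN mulrA -pE//.
  by field; rewrite !f0.
apply: cvgN; apply: cvgM => //; apply: cvgV; first by rewrite mulf_neq0 ?f0.
by apply: cvgM => //; exact: cvg_cst.
Qed.

(** A nondegenerate interval accumulates at each of its points; this makes limits of difference
    quotients along it unique. *)
Lemma within_punctured_proper J u : is_interval J ->
  (exists s1 s2, [/\ J s1, J s2 & s1 < s2]) -> J u ->
  ProperFilter (within J u^').
Proof.
move=> itvJ [s1 [s2 [J1 J2 s12]]] Ju.
apply: Build_ProperFilter => /=; rewrite /within /= => /nbhs_ballP [e /= e0 eP].
have [w Jw wu] : exists2 w, J w & w != u.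
  by have [E|?] := eqVneq s1 u; [exists s2 => //; rewrite -E gt_eqF|exists s1].
(* The bound 1 keeps [u + t * (w - u)] on the segment from [u] to [w], hence in [J]; the other bound
   keeps it in the ball of radius [e]. *)
pose t := Num.min 1 (e / 2 / `|w - u|).
have wu0 : 0 < `|w - u| by rewrite normr_gt0 subr_eq0.
have t0 : 0 < t by rewrite lt_min ltr01/= !divr_gt0.
have t1 : t <= 1 by rewrite ge_min lexx.
have tE : `|t * (w - u)| < e.
  rewrite normrM gtr0_norm//; apply: (@le_lt_trans _ _ (e / 2)); last first.
    by rewrite ltr_pdivrMr// ltr_pMr// ltrDl.
  by rewrite -ler_pdivlMr// ge_min lexx orbT.
apply: (eP (u + t * (w - u))) => /=.
- by rewrite /ball /= opprD addrA subrr add0r normrN.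
- by rewrite -subr_eq0 addrAC subrr add0r mulf_neq0 ?subr_eq0// gt_eqF.
have [wu'|wu'|E] := ltgtP w u; last by rewrite E eqxx in wu.
  apply: (itvJ w u) => //; apply/andP; split; nra.
apply: (itvJ u w) => //; apply/andP; split; nra.
Qed.

Lemma der_in_quotient J f u l : der_in J f u l ->
  (f v - f u) / (v - u) @[v --> within J u^'] --> l.
Proof.
move=> [p pE pl].
have h : p v @[v --> within J u^'] --> l.
  apply: cvg_trans pl => A; rewrite /= /nbhs/= /within /= => H.
  exact: cvg_within H.
apply: cvg_trans h; apply: near_eq_cvg.
rewrite near_withinE; near=> v => Jv.
rewrite pE// mulrAC divff ?mul1r// subr_eq0.
by near: v; exact: nbhs_dnbhs_neq.
Unshelve. all: by end_near. Qed.

Lemma der_in_unique J f u l m : is_interval J ->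
  (exists s1 s2, [/\ J s1, J s2 & s1 < s2]) -> J u ->
  der_in J f u l -> der_in J f u m -> l = m.
Proof.
move=> itvJ J2 Ju /der_in_quotient fl /der_in_quotient fm.
have F := within_punctured_proper itvJ J2 Ju.
exact: (cvg_unique _ fl fm).
Qed.

(** Mean value theorem on [[a, b]]: interior points have a neighbourhood inside [J], so the relative
    derivative is an ordinary one there, and at [a] and [b] relative continuity suffices. *)
Lemma der_in0_cst J f : is_interval J ->
  (forall u, J u -> der_in J f u 0) -> forall u v, J u -> J v -> f u = f v.
Proof.
move=> itvJ f0; suff lt_cst a b : J a -> J b -> a < b -> f a = f b.
  by move=> u v Ju Jv; have [?|?|->//] := ltgtP u v; [|symmetry]; exact: lt_cst.
move=> Ja Jb ab.
have sub c : c \in `[a, b] -> J c.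
  by rewrite in_itv /= => /andP[ac cb]; apply: (itvJ a b) => //; apply/andP.
have [||c _] := @MVT R f (fun=> 0) a b ab.
- move=> c cab.
  have Jn : \forall v \near c, J v.
    near=> v; apply: sub; apply: subset_itv_oo_cc.
    by near: v; exact: near_in_itvoo.
  have /= fq := der_in_quotient (f0 c (sub _ (subset_itv_oo_cc cab))).
  apply/is_derive1_caratheodory.
  exists (fun z => if z == c then 0 else (f z - f c) / (z - c)); split.
  + by move=> z; case: eqVneq => [->|zc]; rewrite ?subrr ?mulr0// divfK// subr_eq0.
  + apply/continuous_withinNx; rewrite eqxx.
    have : (f v - f c) / (v - c) @[v --> c^'] --> 0.
      move=> A /fq; rewrite /= /nbhs/= /within/= => H.
      apply: filterS2 Jn H => v Jv H vc; exact: H.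
    apply: cvg_trans; apply: near_eq_cvg; near=> v.
    by rewrite ifN//; near: v; exact: nbhs_dnbhs_neq.
  + by rewrite eqxx.
- apply/subspace_continuousP => c /= cab.
  move=> A /(der_in_cvg (f0 c (sub _ cab))); rewrite /= /nbhs/= /within/= => H.
  by apply: filterS H => v H vab; exact: H (sub _ vab).
by rewrite mul0r => /eqP; rewrite subr_eq0 => /eqP.
Unshelve. all: by end_near. Qed.

End RelativeDerivative.

(** * Dot and cross products in dimension three *)

Section Vectors.
Context {R : realType}.
Implicit Types (u v w : 'I_3 -> R).

Definition dot u v : R := \sum_i u i * v i.

Definition cross u v (i : 'I_3) : R :=
  u (i + 1) * v (i + 2%:R) - u (i + 2%:R) * v (i + 1).

Lemma dotE u v : dot u v = u 0 * v 0 + u 1 * v 1 + u 2%:R * v 2%:R.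
Proof.
rewrite /dot !big_ord_recr big_ord0 /= add0r.
by congr (u _ * v _ + u _ * v _ + u _ * v _); exact: val_inj.
Qed.

Lemma I3_ind (P : 'I_3 -> Prop) : P 0 -> P 1 -> P 2%:R -> forall i, P i.
Proof.
move=> P0 P1 P2 [[|[|[|//]]] lti]; [move: P0|move: P1|move: P2];
  by congr P; exact: val_inj.
Qed.

Lemma crossE u v : [/\ cross u v 0 = u 1 * v 2%:R - u 2%:R * v 1,
  cross u v 1 = u 2%:R * v 0 - u 0 * v 2%:R &
  cross u v 2%:R = u 0 * v 1 - u 1 * v 0].
Proof.
by split; congr (u _ * v _ - u _ * v _); exact: val_inj.
Qed.

Lemma dotC u v : dot u v = dot v u.
Proof. by apply: eq_bigr => i _; rewrite mulrC. Qed.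

Lemma dot_ge0 u : 0 <= dot u u.
Proof. by apply: sumr_ge0 => i _; rewrite -expr2 sqr_ge0. Qed.

Lemma dot_eq0 u : dot u u = 0 -> forall i, u i = 0.
Proof.
move=> /eqP; rewrite psumr_eq0 => [/allP uu i|i _]; last first.
  by rewrite -expr2 sqr_ge0.
by apply/eqP; rewrite -sqrf_eq0 expr2; apply: uu; rewrite mem_index_enum.
Qed.

Lemma dotZDr u v w a b : dot u (fun i => a * v i + b * w i) =
  a * dot u v + b * dot u w.
Proof. by rewrite !dotE; ring. Qed.

Lemma dot_crossl u v : dot u (cross u v) = 0.
Proof. by rewrite dotE; have [-> -> ->] := crossE u v; ring. Qed.

Lemma dot_crossr u v : dot v (cross u v) = 0.
Proof. by rewrite dotE; have [-> -> ->] := crossE u v; ring. Qed.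

(** Triple product expansion; for orthonormal [u], [v] it reduces to [- v], which gives the
    derivative of the binormal. *)
Lemma cross_cross u v i : cross u (cross u v) i = dot u v * u i - dot u u * v i.
Proof.
rewrite !dotE; have [a1 a2 a3] := crossE u (cross u v).
move: i; apply: I3_ind; rewrite ?a1 ?a2 ?a3;
  by have [b1 b2 b3] := crossE u v; rewrite ?b1 ?b2 ?b3; ring.
Qed.

(** For arbitrary [u] and [v], the Gram determinant times [w] is a combination of [u], [v] and
    [cross u v] by a polynomial identity; orthonormality makes the determinant 1. *)
Lemma orthonormal_expansion u v w : dot u u = 1 -> dot v v = 1 ->
  dot u v = 0 -> forall i,
  w i = dot w u * u i + dot w v * v i + dot w (cross u v) * cross u v i.
Proof.
move=> uu vv uv i.
have gram : w i * (dot u u * dot v v - dot u v * dot u v) =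
    (dot w u * dot v v - dot w v * dot u v) * u i +
    (dot w v * dot u u - dot w u * dot u v) * v i +
    dot w (cross u v) * cross u v i.
  rewrite !dotE; have [-> -> ->] := crossE u v.
  by move: i; apply: I3_ind; have [a1 a2 a3] := crossE u v;
    rewrite ?a1 ?a2 ?a3; ring.
by move: gram; rewrite uu vv uv !mulr0 !subr0 !mulr1.
Qed.

Lemma der_in_dot (J : set R) (X Y : R -> 'I_3 -> R) (s : R) (X' Y' : 'I_3 -> R) :
  J s -> (forall i, der_in J (X^~ i) s (X' i)) ->
  (forall i, der_in J (Y^~ i) s (Y' i)) ->
  der_in J (fun t => dot (X t) (Y t)) s (dot X' (Y s) + dot (X s) Y').
Proof.
move=> Js dX dY; rewrite /dot -big_split; apply: der_in_sum => i.
exact: der_inM.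
Qed.

Lemma der_in_cross (J : set R) (X Y : R -> 'I_3 -> R) (s : R)
    (X' Y' : 'I_3 -> R) i :
  J s -> (forall i, der_in J (X^~ i) s (X' i)) ->
  (forall i, der_in J (Y^~ i) s (Y' i)) ->
  der_in J (fun t => cross (X t) (Y t) i) s (cross X' (Y s) i + cross (X s) Y' i).
Proof.
move=> Js dX dY; rewrite /cross addrACA -opprD.
by apply: der_inB => //; apply: der_inM.
Qed.

End Vectors.

(** * Frenet equations and rectifying curves in ordinary Euclidean space *)

Section FrenetCurves.
Context {R : realType}.
Implicit Types (J : set R) (X T N M : R -> 'I_3 -> R) (k : R -> R).

(** [M] is merely a name for the derivative of [N]: its expansion in the frame, like the
    orthogonality of [T] and [N], is a consequence of these fields. *)
Record frenet_curve J X T N M k : Prop := FrenetCurve {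
  frenet_itv : is_interval J;
  frenet_nontriv : exists s1 s2, [/\ J s1, J s2 & s1 < s2];
  frenet_derX : forall s, J s -> forall i, der_in J (X^~ i) s (T s i);
  frenet_derT : forall s, J s -> forall i, der_in J (T^~ i) s (k s * N s i);
  frenet_derN : forall s, J s -> forall i, der_in J (N^~ i) s (M s i);
  frenet_TT : forall s, J s -> dot (T s) (T s) = 1;
  frenet_NN : forall s, J s -> dot (N s) (N s) = 1;
  frenet_k : forall s, J s -> k s != 0 }.

Definition torsion T N M (s : R) : R := dot (M s) (cross (T s) (N s)).

Section FrenetEquations.
Context J X T N M k (C : frenet_curve J X T N M k).
Let B (s : R) := cross (T s) (N s).
Let tau := torsion T N M.

(** Serves to differentiate constant scalar products; it rests on uniqueness of the relative
    derivative. *)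
Lemma frenet_der_cst f c s l : J s -> (forall t, J t -> f t = c) ->
  der_in J f s l -> l = 0.
Proof.
move=> Js fc fl.
apply: (der_in_unique (frenet_itv C) (frenet_nontriv C) Js fl).
by apply: der_in_eq (der_in_cst _ c _) => // v Jv; rewrite fc.
Qed.

(** Differentiating [dot T T = 1] gives [2 * k * dot T N = 0], and [k] does not vanish. *)
Lemma frenet_TN s : J s -> dot (T s) (N s) = 0.
Proof.
move=> Js; have dT := frenet_derT C Js.
have := frenet_der_cst Js (frenet_TT C) (der_in_dot Js dT dT).
have -> : dot (fun i => k s * N s i) (T s) + dot (T s) (fun i => k s * N s i) =
  2 * k s * dot (T s) (N s) by rewrite !dotE; ring.
by move=> /eqP; rewrite !mulf_eq0 pnatr_eq0 (negbTE (frenet_k C Js)) => /eqP.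
Qed.

(** The components along [N] and [T] come from differentiating [dot N N = 1] and [dot T N = 0]; the
    one along [B] is the torsion by definition. *)
Lemma frenet_M s i : J s -> M s i = - k s * T s i + tau s * B s i.
Proof.
move=> Js; have dN := frenet_derN C Js.
have MN : dot (M s) (N s) = 0.
  have := frenet_der_cst Js (frenet_NN C) (der_in_dot Js dN dN).
  by rewrite (dotC (N s)); lra.
have MT : dot (M s) (T s) = - k s.
  have := frenet_der_cst Js frenet_TN (der_in_dot Js (frenet_derT C Js) dN).
  have -> : dot (fun i => k s * N s i) (N s) = k s * dot (N s) (N s).
    by rewrite !dotE; ring.
  by rewrite (frenet_NN C Js) (dotC (T s)); lra.
rewrite (orthonormal_expansion (M s) (frenet_TT C Js) (frenet_NN C Js)
  (frenet_TN Js) i).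
by rewrite MN MT mul0r addr0.
Qed.

(** In the product rule for [cross T N], the term with [T' = k N] vanishes, and only the
    [B]-component of [M] survives the product with [T]. *)
Lemma frenet_derB s i : J s -> der_in J (B^~ i) s (- (tau s * N s i)).
Proof.
move=> Js.
have := der_in_cross i Js (frenet_derT C Js) (frenet_derN C Js).
congr (der_in _ _ _ _).
have -> : cross (fun i => k s * N s i) (N s) i = 0 by rewrite /cross; ring.
have -> : cross (T s) (M s) i = tau s * cross (T s) (B s) i.
  by rewrite /cross !(frenet_M _ Js); rewrite /B /cross; ring.
by rewrite cross_cross (frenet_TT C Js) (frenet_TN Js); ring.
Qed.

Lemma rectifying_torsion_linear :
  (forall s, J s -> dot (X s) (N s) = 0) ->
  exists c d, c != 0 /\ forall s, J s -> tau s / k s = c * s + d.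
Proof.
move=> XN; have [s1 [s2 [J1 J2 s12]]] := frenet_nontriv C.
(* The constants of integration, here and for [XB], are read off at [s1]. *)
have XT s : J s -> dot (X s) (T s) = s + (dot (X s1) (T s1) - s1).
  move=> Js; suff : dot (X s) (T s) - s = dot (X s1) (T s1) - s1 by lra.
  pose f t := dot (X t) (T t) - t.
  apply: (@der_in0_cst _ _ f (frenet_itv C) _ _ _ Js J1) => {s Js} s Js.
  have := der_inB Js (der_in_dot Js (frenet_derX C Js) (frenet_derT C Js))
    (der_in_id J s).
  congr (der_in _ _ _ _); rewrite (frenet_TT C Js).
  have -> : dot (X s) (fun i => k s * N s i) = k s * dot (X s) (N s).
    by rewrite !dotE; ring.
  by rewrite XN//; ring.
have XB s : J s -> dot (X s) (B s) = dot (X s1) (B s1).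
  move=> Js; pose f t := dot (X t) (B t).
  apply: (@der_in0_cst _ _ f (frenet_itv C) _ _ _ Js J1) => {s Js} s Js.
  have := der_in_dot Js (frenet_derX C Js) (fun i => frenet_derB i Js).
  congr (der_in _ _ _ _); rewrite dot_crossl.
  have -> : dot (X s) (fun i => - (tau s * N s i)) = - tau s * dot (X s) (N s).
    by rewrite !dotE; ring.
  by rewrite XN//; ring.
set b := dot (X s1) (B s1) in XB; set c0 := _ - s1 in XT.
have tb s : J s -> tau s * b = k s * (s + c0).
  move=> Js.
  have := frenet_der_cst Js XN
    (der_in_dot Js (frenet_derX C Js) (frenet_derN C Js)).
  rewrite (frenet_TN Js).
  have -> : dot (X s) (M s) =
      - k s * dot (X s) (T s) + tau s * dot (X s) (B s).
    by rewrite -dotZDr; apply: eq_bigr => i _; rewrite frenet_M.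
  by rewrite XB// XT//; lra.
have b0 : b != 0.
  apply/eqP => b0.
  have z s : J s -> s + c0 = 0.
    move=> Js; have /esym/eqP := tb s Js.
    by rewrite b0 mulr0 mulf_eq0 (negbTE (frenet_k C Js)) => /eqP.
  by have := z _ J1; have := z _ J2; lra.
(* Solving [tau s * b = k s * (s + c0)] for [tau / k] gives this slope and intercept. *)
exists b^-1, (c0 / b); split; first by rewrite invr_neq0.
move=> s Js; have ks := frenet_k C Js.
have -> : tau s = k s * (s + c0) / b by rewrite -tb// mulfK.
by field; rewrite ks b0.
Qed.

Lemma torsion_linear_rectifying c d : c != 0 ->
  (forall s, J s -> tau s / k s = c * s + d) ->
  exists P : 'I_3 -> R,
    forall s, J s -> dot (fun i => X s i - P i) (N s) = 0.
Proof.
move=> c0 tk; have [s1 [_ [J1 _ _]]] := frenet_nontriv C.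
(* Expected position relative to the sought point: inverting the constants of the direct implication
   gives tangential component [s + d / c] and binormal component [1 / c]. *)
pose Y s i := (s + d / c) * T s i + c^-1 * B s i.
pose P s i := X s i - Y s i.
have PE s i : J s -> P s i = P s1 i.
  move=> Js; pose f t := P t i.
  apply: (@der_in0_cst _ _ f (frenet_itv C) _ _ _ Js J1) => {s Js} s Js.
  have dY := der_inD (der_inM Js (der_inD (der_in_id J s) (der_in_cst J (d / c) s))
     (frenet_derT C Js i)) (der_inZ c^-1 Js (frenet_derB i Js)).
  have := der_inB Js (frenet_derX C Js i) dY.
  have ks := frenet_k C Js.
  (* The [N]-terms of the derivative of [Y] cancel because [(s + d / c) * k = tau / c]; what remains
     is [T], the derivative of [X]. *)
  congr (der_in _ _ _ _).
  have -> : tau s = (c * s + d) * k s by rewrite -tk// divfK.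
  by field.
exists (P s1) => s Js.
have -> : dot (fun i => X s i - P s1 i) (N s) = dot (N s) (Y s).
  rewrite dotC; apply: eq_bigr => i _; rewrite -(PE s)// /P.
  by congr (_ * _); ring.
by rewrite dotZDr dotC (frenet_TN Js) dot_crossr !mulr0 addr0.
Qed.

End FrenetEquations.
End FrenetCurves.

(** * Translation of multiplicative calculus and geometry into logarithmic coordinates *)

Section LogarithmicCoordinates.
Context {R : realType}.
Implicit Types (I : set R) (f : R -> R) (s l : R) (x : R -> 'rV[R]_3).

Definition ln_set I : set R := [set v | I (expR v)].

Definition logv (y : 'rV[R]_3) (i : 'I_3) : R := ln (y 0 i).

Lemma ln_set_interval I : minterval I -> is_interval (ln_set I) /\
  exists s1 s2, [/\ ln_set I s1, ln_set I s2 & s1 < s2].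
Proof.
move=> [itvI Ipos [s1 [s2 [I1 I2 s12]]]]; split.
  move=> u v /= Iu Iv w /andP[uw wv]; apply: (itvI _ _ Iu Iv).
  by rewrite !ler_expR uw wv.
have p1 := Ipos _ I1; have p2 := Ipos _ I2.
exists (ln s1), (ln s2).
by rewrite /ln_set /= !lnK ?posrE//; split => //; rewrite ltr_ln ?posrE.
Qed.

(** Substitution [h = exp (v - ln s)]: then [madd s h] is [exp v], and [h != 1] amounts to
    [v != ln s]. *)
Lemma mincr_fmap I s : 0 < s ->
  expR (v - ln s) @[v --> within (ln_set I) (ln s)^'] --> mincr I s.
Proof.
move=> s0.
have h : expR (v - ln s) @[v --> ln s] --> (1 : R).
  rewrite -(@expR0 R) -(subrr (ln s)).
  apply: continuous_comp; last exact: continuous_expR.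
  by apply: cvgB; [exact: cvg_id|exact: cvg_cst].
move=> A nA.
have H : \forall v \near ln s, expR (v - ln s) != 1 ->
  I (madd s (expR (v - ln s))) -> A (expR (v - ln s)) := h _ nA.
suff : \forall v \near ln s,
  v != ln s -> ln_set I v -> A (expR (v - ln s)) by [].
apply: filterS H => v H vs Iv; apply: H.
  by rewrite -(@expR0 R) (inj_eq (@expR_inj R)) subr_eq0.
by rewrite /madd expRK addrC subrK.
Qed.

(** Inverse substitution [v = ln s + ln h]; the target filter is not punctured, as the Caratheodory
    form requires. *)
Lemma mincr_ln I s : 0 < s ->
  ln s + ln h @[h --> mincr I s] --> within (ln_set I) (nbhs (ln s)).
Proof.
move=> s0.
have c : ln s + ln h @[h --> (1 : R)] --> ln s.
  rewrite -[X in _ --> X]addr0 -(@ln1 R).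
  by apply: cvgD; [exact: cvg_cst|exact: continuous_ln].
move=> A nA.
have H : \forall h \near (1 : R), ln_set I (ln s + ln h) -> A (ln s + ln h) := c _ nA.
suff : \forall h \near (1 : R), h != 1 -> I (madd s h) -> A (ln s + ln h) by [].
by apply: filterS H => h H _ Ih; apply: H.
Qed.

Lemma mincr_proper I s : minterval I -> I s -> ProperFilter (mincr I s).
Proof.
move=> hI Is; have [itvJ J2] := ln_set_interval hI.
have s0 : 0 < s by have [_ + _] := hI; exact.
have Js : ln_set I (ln s) by rewrite /ln_set /= lnK.
have F := within_punctured_proper itvJ J2 Js.
apply: Build_ProperFilter => /(mincr_fmap s0) /=.
exact: filter_not_empty.
Qed.

Lemma mquotE f s h :
  mquot f s h = expR ((ln (f (madd s h)) - ln (f s)) / ln h).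
Proof. by rewrite /mquot /mdiv /msub expRK. Qed.

Lemma mquot_cvg_der_in I f s l : 0 < s -> 0 < l ->
  mquot f s h @[h --> mincr I s] --> l ->
  der_in (ln_set I) (fun v => ln (f (expR v))) (ln s) (ln l).
Proof.
move=> s0 l0 fl; set F := fun v => _.
(* The logarithmic difference quotient, completed at [ln s] by its limit; [ln] is continuous at [l]
   because [l] is positive. *)
exists (fun v => if v == ln s then ln l else (F v - F (ln s)) / (v - ln s)).
  move=> v _; case: eqVneq => [->|vs]; first by rewrite !subrr mul0r.
  by rewrite mulrC divfK// subr_eq0.
have h : ln (mquot f s (expR (v - ln s))) @[v --> within (ln_set I) (ln s)^']
    --> ln l.
  have fl' := cvg_comp (fun v => expR (v - ln s)) (mquot f s) (mincr_fmap s0) fl.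
  exact: cvg_comp fl' (continuous_ln l0).
move=> A Al.
have H : \forall v \near ln s, v != ln s -> ln_set I v ->
  A (ln (mquot f s (expR (v - ln s)))) := h _ Al.
suff : \forall v \near ln s, ln_set I v ->
  A (if v == ln s then ln l else (F v - F (ln s)) / (v - ln s)) by [].
apply: filterS H => v H Iv.
case: eqVneq => [_|vs]; first exact: nbhs_singleton.
have := H vs Iv.
have sv : ln s + (v - ln s) = v by rewrite addrC subrK.
by rewrite mquotE !expRK /madd expRK sv /F lnK.
Qed.

Lemma der_in_mquot_cvg I f s l : 0 < s ->
  der_in (ln_set I) (fun v => ln (f (expR v))) (ln s) l ->
  mquot f s h @[h --> mincr I s] --> expR l.
Proof.
move=> s0 [q qE ql].
have h : expR (q (ln s + ln h)) @[h --> mincr I s] --> expR l.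
  have ql' := cvg_comp (fun h => ln s + ln h) q (mincr_ln s0) ql.
  exact: (cvg_comp (q \o (fun h => ln s + ln h)) (@expR R) ql' (@continuous_expR R l)).
apply: cvg_trans h; apply: near_eq_cvg.
rewrite /mincr near_withinE; near=> h => Ih.
have h1 : h != 1 by near: h; exact: nbhs_dnbhs_neq.
(* Positivity together with [h != 1] ensures [ln h != 0], so that the quotient can be simplified. *)
have h0 : 0 < h.
  by near: h; apply: nbhs_dnbhs; exact: lt_nbhsr.
have := qE (ln s + ln h) Ih.
rewrite mquotE lnK// /madd => ->; congr expR.
by rewrite addrAC subrr add0r mulrAC divff ?mul1r// ln_eq0.
Unshelve. all: by end_near. Qed.

(** [mderiv] is a [lim], meaningful only once convergence is known; any relative derivative supplies
    that convergence and identifies the limit. *)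
Lemma der_in_ln_mderiv I f s l : minterval I -> I s ->
  der_in (ln_set I) (fun v => ln (f (expR v))) (ln s) l ->
  der_in (ln_set I) (fun v => ln (f (expR v))) (ln s) (ln (mderiv I f s)).
Proof.
move=> hI Is fl; have s0 : 0 < s by have [_ + _] := hI; exact.
have F := mincr_proper hI Is.
by rewrite /mderiv (cvg_lim _ (der_in_mquot_cvg s0 fl))// expRK.
Qed.

Lemma mderivable_der_in I f s : minterval I -> I s -> mderivable I f s ->
  der_in (ln_set I) (fun v => ln (f (expR v))) (ln s) (ln (mderiv I f s)).
Proof.
move=> hI Is [l l0 fl]; apply: (@der_in_ln_mderiv _ _ _ (ln l)) => //.
by apply: mquot_cvg_der_in => //; have [_ + _] := hI; exact.
Qed.

(** A fixed translation cancels in the difference quotient, so biregularity and the normal are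
    unaffected by it. *)
Lemma mvderiv_mvsub I x p :
  mvderiv I (fun s => mvsub (x s) p) = mvderiv I x.
Proof.
apply/funext => s; apply/rowP => i; rewrite [LHS]mxE [RHS]mxE /mderiv.
have -> // : mquot (fun u => mvsub (x u) p 0 i) s = mquot (fun u => x u 0 i) s.
apply/funext => h.
by rewrite !mquotE !mxE /msub !expRK opprB addrA subrK.
Qed.

Lemma ln_minner (y z : 'rV[R]_3) : ln (minner y z) = dot (logv y) (logv z).
Proof. exact: expRK. Qed.

Lemma ln_mnorm (y : 'rV[R]_3) : ln (mnorm y) = Num.sqrt (dot (logv y) (logv y)).
Proof. by rewrite /mnorm /msqrt expRK ln_minner. Qed.

Lemma logv_mcross (y z : 'rV[R]_3) :
  logv (mcross y z) = cross (logv y) (logv z).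
Proof. by apply/funext => i; rewrite /logv mxE expRK. Qed.

Lemma mcollinear_logv0 (y z : 'rV[R]_3) :
  (forall i, logv z i = 0) -> mcollinear y z.
Proof.
rewrite /logv => z0; apply/rowP => i.
by rewrite !mxE !z0 !mulr0 subrr expR0.
Qed.

Lemma logv_mvdiv (y : 'rV[R]_3) a i : logv (mvdiv y a) i = logv y i / ln a.
Proof. by rewrite /logv mxE expRK. Qed.

Lemma logv_mvsub (y z : 'rV[R]_3) :
  logv (mvsub y z) = fun i => logv y i - logv z i.
Proof. by apply/funext => i; rewrite /logv mxE expRK. Qed.

Section Curve.
Context I x.
Let k v := ln (mcurvature I x (expR v)).

(** Zero curvature would make the second derivative the zero vector, which is collinear with every
    vector. *)
Lemma mbiregular_curvature_neq0 v : mbiregular I x -> ln_set I v -> k v != 0.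
Proof.
move=> hb Iv; apply/negP => /eqP.
rewrite /k /mcurvature ln_mnorm => /eqP.
rewrite sqrtr_eq0 => le0; apply: (hb _ Iv).
by apply/mcollinear_logv0/dot_eq0/eqP; rewrite eq_le le0 dot_ge0.
Qed.

Lemma frenet_curve_logv : minterval I -> mdifferentiable I 3 x ->
  marclength I x -> mbiregular I x ->
  frenet_curve (ln_set I) (logv \o x \o expR) (logv \o mtangent I x \o expR)
    (logv \o mnormal I x \o expR) (logv \o mvderiv I (mnormal I x) \o expR) k.
Proof.
move=> hI [d1 [d2 [d3 _]]] ha hb; have [itvJ J2] := ln_set_interval hI.
pose X2 v := logv (mvderiv I (mvderiv I x) (expR v)).
have k0 v : ln_set I v -> k v != 0 by exact: mbiregular_curvature_neq0.
have kE v : k v = Num.sqrt (dot (X2 v) (X2 v)) by rewrite /k ln_mnorm.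
have NE v i : logv (mnormal I x (expR v)) i = X2 v i / k v.
  by rewrite logv_mvdiv.
have der (y : R -> 'rV[R]_3) :
    (forall s, I s -> forall i, mderivable I (fun u => y u 0 i) s) ->
    forall v, ln_set I v -> forall i, der_in (ln_set I)
      (fun u => logv (y (expR u)) i) v (logv (mvderiv I y (expR v)) i).
  move=> dy v Iv i; have := mderivable_der_in hI Iv (dy _ Iv i).
  by rewrite expRK /logv mxE.
have XX0 v : ln_set I v -> 0 < dot (X2 v) (X2 v).
  by move=> Iv; rewrite -sqrtr_gt0 -kE lt_neqAle eq_sym k0// kE sqrtr_ge0.
split => //.
- by move=> v Iv i; have := der x d1 v Iv i.
- move=> v Iv i /=; rewrite NE mulrC divfK ?k0//.
  by have := der _ d2 v Iv i.
(* Differentiability of the normal is derived here: it is the second derivative over its norm, so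
   the third order hypothesis and the quotient and square root rules apply. *)
- move=> v Iv i /=; rewrite {2}/logv mxE -{1}[v]expRK.
  have dk := der_in_sqrt Iv (fun v _ => dot_ge0 (X2 v)) (XX0 _ Iv)
    (der_in_dot Iv (der _ d3 _ Iv) (der _ d3 _ Iv)).
  have sq0 u : ln_set I u -> Num.sqrt (dot (X2 u) (X2 u)) != 0.
    by rewrite -kE; exact: k0.
  have dN := der_inM Iv (der _ d3 _ Iv i) (der_inV Iv sq0 dk).
  apply: der_in_ln_mderiv => //; rewrite expRK.
  by apply: der_in_eq dN => // u _; rewrite -kE -NE.
- move=> v Iv; have := ha _ Iv => /(congr1 (@ln R)).
  rewrite ln_mnorm expRK => /(congr1 (fun a => a ^+ 2)).
  by rewrite sqr_sqrtr ?dot_ge0// expr1n.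
- move=> v Iv /=.
  have -> : logv (mnormal I x (expR v)) = fun i => X2 v i / k v.
    by apply/funext => i; exact: NE.
  have -> : dot (fun i => X2 v i / k v) (fun i => X2 v i / k v) =
    dot (X2 v) (X2 v) / k v ^+ 2.
    rewrite /dot mulr_suml; apply: eq_bigr => i _.
    by rewrite mulf_div expr2.
  by rewrite kE sqr_sqrtr ?dot_ge0// divff// gt_eqF// XX0.
Qed.

Lemma torsion_logv v :
  torsion (logv \o mtangent I x \o expR) (logv \o mnormal I x \o expR)
    (logv \o mvderiv I (mnormal I x) \o expR) v = ln (mtorsion I x (expR v)).
Proof. by rewrite /torsion /= -logv_mcross -ln_minner. Qed.

End Curve.
End LogarithmicCoordinates.

(** * Return to multiplicative coordinates *)

Unset Implicit Arguments.
Set Strict Implicit.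

Theorem proposition4p2 (R : realType) (I : set R) (x : R -> 'rV[R]_3)
    (hI : minterval I)
    (hpos : forall s : R, I s -> mpos (x s))
    (hdiff : mdifferentiable I 3 x)
    (harc : marclength I x)
    (hbireg : mbiregular I x) :
  (mrectifying I x ->
     exists c d : R, [/\ 0 < c, 0 < d, c <> mreal0 &
       forall s : R, I s ->
         mdiv (mtorsion I x s) (mcurvature I x s) = madd (mmul c s) d /\
         madd (mmul c s) d = expR (ln c * ln s + ln d)]) /\
  ((exists c d : R, [/\ 0 < c, 0 < d, c <> mreal0 &
       forall s : R, I s ->
         mdiv (mtorsion I x s) (mcurvature I x s) = madd (mmul c s) d /\
         madd (mmul c s) d = expR (ln c * ln s + ln d)]) ->
     mrectifying_up_to_translation I x).
Proof.
have C := frenet_curve_logv hI hdiff harc hbireg.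
have Ipos s : I s -> 0 < s by have [_ + _] := hI; exact.
have IJ s : I s -> ln_set I (ln s).
  by move=> Is; rewrite /ln_set /= lnK ?posrE ?Ipos.
split.
  move=> [_ rect].
  have XN v : ln_set I v ->
      dot (logv (x (expR v))) (logv (mnormal I x (expR v))) = 0.
    by move=> Jv; rewrite -ln_minner rect// ln1.
  have [c [d [c0 tk]]] := rectifying_torsion_linear C XN.
  (* Exponentials of the ordinary slope and intercept; slope nonzero means [expR c] differs from
     [mreal0], which is 1. *)
  exists (expR c), (expR d); split; rewrite ?expR_gt0//.
    by rewrite /mreal0 -expR0 => /expR_inj; exact/eqP.
  move=> s Is; rewrite /madd /mmul !expRK; split=> //.
  by have := tk _ (IJ _ Is);
    rewrite torsion_logv lnK ?posrE ?Ipos// => <-.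
move=> [c [d [c0 d0 c1 tk]]].
have lc0 : ln c != 0 by rewrite ln_eq0//; exact/eqP.
have tk' v : ln_set I v ->
    torsion (logv \o mtangent I x \o expR) (logv \o mnormal I x \o expR)
      (logv \o mvderiv I (mnormal I x) \o expR) v /
    ln (mcurvature I x (expR v)) = ln c * v + ln d.
  move=> Jv; rewrite torsion_logv.
  by have [+ E] := tk _ Jv; rewrite E expRK => /expR_inj.
have [P PN] := torsion_linear_rectifying C lc0 tk'.
(* The translation point whose logarithmic coordinates are [P]. *)
exists (\row_i expR (P i)); first by move=> i; rewrite mxE expR_gt0.
rewrite /mrectifying /mbiregular /mnormal mvderiv_mvsub; split=> // s Is.
rewrite -[RHS]expR0 -(PN _ (IJ _ Is)) /= lnK ?posrE ?Ipos//.
transitivity (expR (dot (logv (mvsub (x s) (\row_i expR (P i))))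
  (logv (mnormal I x s)))) => //.
rewrite logv_mvsub; congr (expR (dot _ _)); apply/funext => i.
by rewrite {2}/logv mxE expRK.
Qed.
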